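(* Let $\varphi:S\to X$ be an address map such that for all $s,t\in S$ and each digit $i\in D$, $$\varphi(s)=\varphi(t)\iff\varphi(is)=\varphi(it).$$ The following conditions are equivalent. (i) $\varphi$ is post-critically finite. (ii) There is a topology-generating automaton $G=(V,D^2,E,o)$ accepting the double addresses of $\varphi$ (that is, a pair $(s,t)\in S\times S$ is accepted by $G$ if and only if $\varphi(s)=\varphi(t)$) in which there is no directed path between two different directed cycles of the graph $(V,E)$, where the loops at $o$ are disregarded.
   Context: Let $D=\{0,1,\dots,m-1\}$ and $S=D^{\mathbb N}$, the set of sequences (addresses). An address map is a function $\varphi$ from $S$ onto a set $X$. The map $\varphi$ is called post-critically finite if there are only finitely many pairs $(s,t)$ with $\varphi(s)=\varphi(t)$ and $s_1\ne t_1$, and all sequences $s,t$ occurring in these pairs are preperiodic (eventually periodic). A topology-generating automaton $G=(V,D^2,E,o)$ is a finite directed graph with vertex set $V$ (states), edge set $E$ (loops and multiple edges allowed), each edge labelled by an element of $D^2$, and an initial state $o\in V$, such that: (1) each vertex has an outgoing edge and can be reached by a directed path from $o$; (2) no vertex has two outgoing edges with the same label; (3) to each state $c$ there is an 'inverse' state $c-$ such that for every edge from $b$ to $c$ labelled $(i,j)$ there is an edge from $b-$ to $c-$ labelled $(j,i)$, with $o-=o$ and $(c-)-=c$; (4) $o$ has loops with label $(i,i)$ for each $i\in D$. Standing assumption: the loops in (4) are the only incoming edges to $o$. A pair of sequences $(i_1i_2\dots,j_1j_2\dots)$ is accepted if there is a directed path of edges starting in $o$ with labels $(i_1,j_1),(i_2,j_2),\dots$.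 Parallel edges count as different edges (so two loops with different labels at a state other than $o$ are two different cycles), and two different cycles sharing a vertex count as being joined by a (trivial) path. *)

(* Defs.v *)
From mathcomp Require Import all_boot.
From mathcomp Require Import boolp classical_sets functions cardinality.

Set Implicit Arguments.
Unset Strict Implicit.
Unset Printing Implicit Defensive.

Local Open Scope classical_set_scope.

(* Addresses are indexed from 0: the digit s_(n+1) of the address s is s n. *)
Definition address (m : nat) := nat -> 'I_m.

Definition acons m (i : 'I_m) (s : address m) : address m :=
  fun n => if n is n'.+1 then s n' else i.

Definition address_map m (X : Type) (phi : address m -> X) : Prop :=
  set_surj [set: address m] [set: X] phi.

Definition preperiodic m (s : address m) : Prop :=
  exists k p, 0 < p /\ forall n, k <= n -> s (n + p) = s n.

Definition critical_pairs m (X : Type) (phi : address m -> X) :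
    set (address m * address m) :=
  [set st | phi st.1 = phi st.2 /\ st.1 0 <> st.2 0].

Definition post_critically_finite m (X : Type) (phi : address m -> X) : Prop :=
  finite_set (critical_pairs phi) /\
  forall s t, critical_pairs phi (s, t) -> preperiodic s /\ preperiodic t.

(* Edges form a type of their own, so that loops and parallel edges are
   allowed and parallel edges are different. *)
Record automaton (m : nat) := Automaton {
  state : finType;
  edge : finType;
  source : edge -> state;
  target : edge -> state;
  label : edge -> 'I_m * 'I_m;
  initial : state
}.

Section AutomatonTheory.
Variables (m : nat) (G : automaton m).

Definition adjacent : rel (state G) :=
  fun u v => [exists e : edge G, (source e == u) && (target e == v)].

Definition inverse_states (inv : state G -> state G) : Prop :=
  [/\ inv (initial G) = initial G, involutive inv &
      forall e : edge G, exists f : edge G,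
        [/\ source f = inv (source e), target f = inv (target e) &
            label f = ((label e).2, (label e).1)]].

Record topology_generating : Prop := {
  tg_outgoing : forall c : state G, exists e : edge G, source e = c;
  tg_reachable : forall c : state G, connect adjacent (initial G) c;
  tg_deterministic : forall e f : edge G,
    source e = source f -> label e = label f -> e = f;
  tg_inverse : exists inv, inverse_states inv;
  tg_loops : forall i : 'I_m, exists e : edge G,
    [/\ source e = initial G, target e = initial G & label e = (i, i)];
  (* standing assumption: nothing but these loops enters the initial state *)
  tg_initial : forall e : edge G, target e = initial G ->
    source e = initial G /\ exists i : 'I_m, label e = (i, i)
}.

Definition accepts (s t : address m) : Prop :=
  exists e : nat -> edge G,
    source (e 0) = initial G /\
    forall n, target (e n) = source (e n.+1) /\ label (e n) = (s n, t n).

Definition initial_loop (e : edge G) : bool :=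
  (source e == initial G) && (target e == initial G).

(* A directed cycle is given by its sequence of edges, listed from any one of
   its vertices; it passes through each of its vertices once. *)
Definition directed_cycle (c : seq (edge G)) : bool :=
  [&& c != [::], cycle (fun e f => target e == source f) c,
      uniq (map (@source m G) c) & ~~ has initial_loop c].

Definition same_cycle (c1 c2 : seq (edge G)) : Prop :=
  exists n, c2 = rot n c1.

(* connect is reflexive, so that cycles sharing a vertex are joined; the loops
   at the initial state are irrelevant to it. *)
Definition joined (c1 c2 : seq (edge G)) : Prop :=
  exists e f, [/\ e \in c1, f \in c2 & connect adjacent (source e) (source f)].

Definition no_path_between_cycles : Prop :=
  forall c1 c2, directed_cycle c1 -> directed_cycle c2 ->
    ~ same_cycle c1 c2 -> ~ joined c1 c2.

End AutomatonTheory.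

(* Main.v *)
Require Import Defs.
From mathcomp Require Import all_boot.
From mathcomp Require Import boolp classical_sets functions cardinality.
From mathcomp Require Import zify.

Set Implicit Arguments.
Unset Strict Implicit.
Unset Printing Implicit Defensive.

(** Think of an automaton accepting the double addresses as a device that
reads a pair of sequences.  As long as the two sequences agree it stays at the
initial state; from the first difference on it reads a critical pair, along a
run that avoids the initial loops.  So the theorem compares the number and the
shape of the infinite runs with the position of the cycles in the graph.

From isolated cycles to finitely many preperiodic critical pairs.  Call an edge
recurrent when its target leads back to its source.  A recurrent edge lies on a
directed cycle, and two recurrent edges one of which leads to the other lie on
the same cycle, for otherwise a path would join two different cycles; in
particular a recurrent edge is determined by its source
([recurrent_source_inj]).  A run must revisit states, hence always ends up
among recurrent edges, and by the pigeonhole principle it does so after as many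
steps as there are states ([run_recurrent]).  From then on each edge determines
the next one.  Thus a run is determined by a prefix of bounded length and is
eventually periodic, and so are the pairs of labels that it reads.

From finitely many preperiodic critical pairs to an automaton with isolated
cycles.  Choose [N] and [p] such that two different critical pairs differ
within their first [N] letters and such that all of them have period [p] from
index [N] on.  Arrange the critical pairs in a tree of prefixes, rooted at the
initial state, and from depth [N] on, where the branches are separated, bend
every branch back into a loop of length [p].  Apart from the loops at the root,
the resulting graph is a finite tree with one cycle attached to each leaf: no
edge leaves a cycle, so different cycles are not joined
([functional_cycles_isolated]).  Exchanging the two members of each critical
pair gives the inverse states.  A pair of sequences is accepted if the two are
equal, or agree up to some index and continue from there with a critical pair;
by cancellation of common first digits these are exactly the double addresses
([double_address_critical]). *)

(** * Sequences *)

Lemma first_difference (T : eqType) (s t : nat -> T) : s <> t ->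
  exists n, s n <> t n /\ forall k, k < n -> s k = t k.
Proof.
move=> neq_st; have ex_off : exists n, s n != t n.
  apply: contra_notP neq_st => /forallNP eq_st; apply/funext=> n.
  by have /negP := eq_st n; rewrite negbK => /eqP.
case: (ex_minnP ex_off) => n /eqP off_n min_n; exists n; split=> // k kn.
by apply/eqP; apply: contraLR kn; rewrite -leqNgt => /min_n.
Qed.

(** The bound on [j] matters: it makes the time at which a run gets caught in a
cycle uniform over all runs. *)
Lemma sequence_repeats (T : finType) (u : nat -> T) (k : nat) :
  exists i j, [/\ k <= i, i < j, j <= k + #|T| & u i = u j].
Proof.
have : ~~ injectiveb (fun i : 'I_#|T|.+1 => u (k + i)).
  by apply/negP=> /injectiveP /leq_card; rewrite card_ord ltnn.
case/injectivePn=> i [j neq_ij eq_u].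
have := ltn_ord i; have := ltn_ord j.
case: (ltngtP i j) neq_ij => [ij | ji | /val_inj ->]; last by rewrite eqxx.
- by exists (k + i), (k + j); split=> //; lia.
- by exists (k + j), (k + i); split=> //; lia.
Qed.

Lemma finite_set_enumeration (T : Type) (A : set T) : finite_set A ->
  exists n (g : 'I_n -> T), injective g /\ forall x, A x <-> exists i, g i = x.
Proof.
case=> n /card_set_bijP[f [f_sub f_inj f_surj]].
have /choice[g gP] : forall i : 'I_n, exists x, A x /\ f x = i.
  by move=> i; have [x Ax fx] := f_surj i (ltn_ord i); exists x.
exists n, g; split=> [i j gij | x].
  by apply: val_inj; rewrite /= -(gP i).2 -(gP j).2 gij.
split=> [Ax | [i <-]]; last exact: (gP i).1.
exists (Ordinal (f_sub x Ax)); apply: f_inj; rewrite ?inE ?(gP _).2 //.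
exact: (gP _).1.
Qed.

Lemma uniform_bound (I : finType) (P : I -> nat -> Prop) :
  (forall i, exists k, forall l, k <= l -> P i l) ->
  exists K, forall i l, K <= l -> P i l.
Proof.
case/choice=> k kP; exists (\max_i k i) => i l kl; apply: kP.
exact: leq_trans (leq_bigmax i) kl.
Qed.

Lemma period_mul (T : Type) (x : nat -> T) (k p q : nat) : p %| q ->
  (forall n, k <= n -> x (n + p) = x n) -> forall n, k <= n -> x (n + q) = x n.
Proof.
move=> /dvdnP[d ->] per_x n kn; elim: d => [|d IHd]; first by rewrite mul0n addn0.
by rewrite -IHd mulSn addnCA addnC per_x // (leq_trans kn) ?leq_addr.
Qed.

(** The product of the individual periods serves all members of the family. *)
Lemma uniform_period (I : finType) (T : Type) (x : I -> nat -> T) :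
  (forall i, exists k p, 0 < p /\ forall n, k <= n -> x i (n + p) = x i n) ->
  exists p, 0 < p /\ exists K, forall i n, K <= n -> x i (n + p) = x i n.
Proof.
move=> per_x; have /choice[p pP] : forall i, exists p, 0 < p /\
    exists k, forall n, k <= n -> x i (n + p) = x i n.
  by move=> i; have [k [p [p_gt0 per]]] := per_x i; exists p; split=> //; exists k.
exists (\prod_i p i); split; first by apply: prodn_gt0 => i; exact: (pP i).1.
apply: uniform_bound => i; have [_ [k per]] := pP i; exists k.
apply: period_mul per; rewrite (bigD1 i) //=; exact: dvdn_mulr.
Qed.

Lemma uniform_separation (I : finType) (T : Type) (x : I -> nat -> T) :
  (forall i j, (forall k, x i k = x j k) -> i = j) ->
  exists K, forall n, K <= n -> forall i j, (forall k, k < n -> x i k = x j k) -> i = j.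
Proof.
move=> sep_x; suff [K KP] : exists K, forall (ij : I * I) n, K <= n ->
    (forall k, k < n -> x ij.1 k = x ij.2 k) -> ij.1 = ij.2.
  by exists K => n Kn i j; exact: (KP (i, j) n Kn).
apply: uniform_bound => -[i j] /=; have [->|neq_ij] := pselect (i = j).
  by exists 0.
have [k neq_k] : exists k, x i k <> x j k.
  apply: contra_notP neq_ij => /forallNP eq_x; apply: sep_x => k.
  exact: contrapT (eq_x k).
by exists k.+1 => l kl eq_l; case: neq_k; exact: eq_l.
Qed.

(** * Directed cycles *)

Section DirectedCycles.
Variables (m : nat) (G : automaton m).
Implicit Types (e f g : edge G) (c : seq (edge G)).

Lemma adjacent_edge e : adjacent (source e) (target e).
Proof. by apply/existsP; exists e; rewrite !eqxx. Qed.

Lemma directed_cycle_uniq c : directed_cycle c -> uniq c.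
Proof. by case/and4P=> _ _ /map_uniq. Qed.

Lemma directed_cycle_next c e : directed_cycle c -> e \in c ->
  next c e \in c /\ target e = source (next c e).
Proof.
case/and4P=> _ cyc_c _ _ ec; rewrite mem_next; split=> //.
exact/eqP/(next_cycle cyc_c).
Qed.

(** Since a directed cycle repeats no edge, following it from any of its edges
is iterating one function. *)
Lemma directed_cycle_iter c e f : directed_cycle c -> e \in c -> f \in c ->
  exists n, f = iter n (next c) e.
Proof.
move=> /directed_cycle_uniq /cycle_next cyc_c ec fc; exists (findex (next c) e f).
by rewrite iter_findex // (fconnect_cycle cyc_c).
Qed.

Lemma directed_cycle_connect c e f : directed_cycle c -> e \in c -> f \in c ->
  connect (@adjacent m G) (source e) (source f).
Proof.
move=> cyc_c ec fc; have [n ->] := directed_cycle_iter cyc_c ec fc.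
elim: n e ec {fc} => [|n IHn] e ec //.
have [nc te] := directed_cycle_next cyc_c ec.
rewrite iterSr; apply: connect_trans (IHn _ nc); rewrite -te.
exact/connect1/adjacent_edge.
Qed.

Lemma directed_cycle_source_inj c e f : directed_cycle c -> e \in c -> f \in c ->
  source e = source f -> e = f.
Proof.
case/and4P=> _ _ uniq_c _; elim: c uniq_c => // g c IHc /= /andP[gc uniq_c].
rewrite !inE => /predU1P[-> | ec] /predU1P[-> | fc] // ef; last exact: IHc.
- by rewrite ef map_f in gc.
- by rewrite -ef map_f in gc.
Qed.

(** The edge [e] ranges over the edges that may precede the lifted path, which
is what is needed to close a path into a cycle of edges. *)
Lemma lift_path (x : state G) (p : seq (state G)) :
  path (@adjacent m G) x p ->
  exists es : seq (edge G), map (@source m G) es = belast x p /\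
    forall e, target e = x ->
      path (fun e f => target e == source f) e es /\ target (last e es) = last x p.
Proof.
elim: p x => [|y p IHp] x /=; first by exists [::]; split=> // e ->.
case/andP=> /existsP[g /andP[/eqP sg /eqP tg]] /IHp[es [ses es_path]].
exists (g :: es); split=> [|e te] /=; first by rewrite ses sg.
by have [-> ->] := es_path g tg; rewrite te sg eqxx.
Qed.

End DirectedCycles.

(** * Recurrent edges and runs in automata with isolated cycles *)

Section Recurrence.
Variables (m : nat) (G : automaton m).
Hypothesis initial_entry :
  forall e : edge G, target e = initial G -> initial_loop e.
Implicit Types (e f g : edge G) (c : seq (edge G)).

Definition recurrent e : bool :=
  ~~ initial_loop e && connect (@adjacent m G) (target e) (source e).

(** A path into the initial state never was anywhere else, as only loops enter
that state. *)
Lemma connect_initial (x : state G) :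
  connect (@adjacent m G) x (initial G) -> x = initial G.
Proof.
case/connectP=> p; elim: p x => [|y p IHp] x //= /andP[xy p_path] last_p.
have y_init := IHp _ p_path last_p; case/existsP: xy => g /andP[/eqP <- /eqP tg].
by have /andP[/eqP] : initial_loop g by apply: initial_entry; rewrite tg.
Qed.

(** Close a simple path from the target of [e] to its source by [e] itself. *)
Lemma recurrent_on_cycle e : recurrent e -> exists2 c, directed_cycle c & e \in c.
Proof.
case/andP=> e_loop conn_e.
have te_init : target e != initial G by apply: contraNneq e_loop => /initial_entry.
have se_init : source e != initial G.
  by apply: contraNneq te_init => se; apply/eqP/connect_initial; rewrite -se.
case/connectP: conn_e => p0 /shortenP[p p_path uniq_p _] last_p.
have [es [ses /(_ e erefl)[es_path es_last]]] := lift_path p_path.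
have sources : map (@source m G) (rcons es e) = target e :: p.
  by rewrite map_rcons ses last_p -lastI.
exists (e :: es); last by rewrite mem_head.
apply/and4P; split=> //.
- by rewrite /= rcons_path es_path es_last last_p eqxx.
- by rewrite -(rot_uniq 1) -map_rot rot1_cons sources.
- apply/hasPn=> g; rewrite -(mem_rot 1) rot1_cons => /(map_f (@source m G)).
  rewrite sources => /(path_connect p_path) conn_g.
  apply: contraNN te_init => /andP[/eqP sg _]; apply/eqP/connect_initial.
  by rewrite -sg.
Qed.

Hypothesis isolated_cycles : no_path_between_cycles G.

(** The cycles through [e] and [f] are joined, hence equal up to rotation. *)
Lemma recurrent_same_cycle e f : recurrent e -> recurrent f ->
  connect (@adjacent m G) (source e) (source f) ->
  exists c, [/\ directed_cycle c, e \in c & f \in c].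
Proof.
move=> /recurrent_on_cycle[c cyc_c ec] /recurrent_on_cycle[d cyc_d fd] conn_ef.
have [[n d_rot]|] := pselect (same_cycle c d).
  by exists c; split=> //; rewrite -(mem_rot n c) -d_rot.
by case/(isolated_cycles cyc_c cyc_d); exists e, f.
Qed.

Lemma recurrent_source_inj e f : recurrent e -> recurrent f ->
  source e = source f -> e = f.
Proof.
move=> rec_e rec_f ef; have conn_ef : connect (@adjacent m G) (source e) (source f).
  by rewrite ef.
have [c [cyc_c ec fc]] := recurrent_same_cycle rec_e rec_f conn_ef.
exact: directed_cycle_source_inj cyc_c ec fc ef.
Qed.

Lemma recurrent_connect_sym e f : recurrent e -> recurrent f ->
  connect (@adjacent m G) (source e) (source f) ->
  connect (@adjacent m G) (source f) (source e).
Proof.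
move=> rec_e rec_f /(recurrent_same_cycle rec_e rec_f)[c [cyc_c ec fc]].
exact: directed_cycle_connect cyc_c fc ec.
Qed.

(** The default value [e] is taken where a run can no longer be continued by a
recurrent edge, which never happens along the runs considered. *)
Definition recurrent_succ e : edge G :=
  odflt e [pick f | recurrent f && (source f == target e)].

Lemma recurrent_succE e f : recurrent f -> source f = target e ->
  recurrent_succ e = f.
Proof.
move=> rec_f sf; rewrite /recurrent_succ; case: pickP => [g | /(_ f)].
  by case/andP=> rec_g /eqP sg; apply: recurrent_source_inj; rewrite // sg.
by rewrite rec_f sf eqxx.
Qed.

Section Run.
Variable r : nat -> edge G.
Hypothesis run_r : forall n, target (r n) = source (r n.+1).
Hypothesis no_loop_r : forall n, ~~ initial_loop (r n).

Lemma run_connect i j : i <= j ->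
  connect (@adjacent m G) (source (r i)) (source (r j)).
Proof.
move=> /subnKC <-; elim: (j - i) => [|n IHn]; first by rewrite addn0.
by apply: connect_trans IHn _; rewrite addnS -run_r connect1 // adjacent_edge.
Qed.

Lemma run_recurrent_repeat i j : i < j -> source (r i) = source (r j) ->
  recurrent (r i).
Proof.
by move=> ij eq_s; rewrite /recurrent no_loop_r /= run_r eq_s run_connect.
Qed.

(** The run repeats a state at some [i] with [i <= k], and again at some [a] with
[k < a].  Both edges are recurrent, so there is also a path back from [a] to
[i], which makes the edge in between recurrent. *)
Lemma run_recurrent k : #|state G| <= k -> recurrent (r k).
Proof.
move=> k_large.
have [i [j [_ ij j_le sij]]] := sequence_repeats (fun n => source (r n)) 0.
have [a [b [ka ab _ sab]]] := sequence_repeats (fun n => source (r n)) k.+1.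
have ik : i <= k by lia.
have rec_i := run_recurrent_repeat ij sij; have rec_a := run_recurrent_repeat ab sab.
have conn_ai := recurrent_connect_sym rec_i rec_a (run_connect (leq_trans ik (ltnW ka))).
rewrite /recurrent no_loop_r run_r /=.
exact: connect_trans (run_connect ka) (connect_trans conn_ai (run_connect ik)).
Qed.

Lemma run_succ n k : #|state G| <= k -> r (n + k) = iter n recurrent_succ (r k).
Proof.
move=> k_large; elim: n => [|n IHn] //=; rewrite -IHn addSn.
by rewrite (@recurrent_succE _ (r (n + k).+1)) // run_recurrent //; lia.
Qed.

Lemma run_preperiodic : exists k p, 0 < p /\ forall n, k <= n -> r (n + p) = r n.
Proof.
have [i [j [i_large ij _ rij]]] := sequence_repeats r #|state G|.
exists i, (j - i); split=> [|n i_n]; first by rewrite subn_gt0.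
rewrite -[in RHS](subnK i_n) (run_succ _ i_large) rij -run_succ; last by lia.
by congr r; lia.
Qed.

End Run.

End Recurrence.

(** * Critical pairs accepted by an automaton with isolated cycles *)

Section AcceptedCriticalPairs.
Variables (m : nat) (G : automaton m).
Hypothesis tgG : topology_generating G.
Hypothesis isolated_cycles : no_path_between_cycles G.

Lemma initial_entry (e : edge G) : target e = initial G -> initial_loop e.
Proof.
by move=> te; have [se _] := tg_initial tgG te; rewrite /initial_loop te se eqxx.
Qed.

(** The first label keeps the run from staying at the initial state, and no edge
comes back to that state. *)
Lemma off_diagonal_run (r : nat -> edge G) :
  (forall n, target (r n) = source (r n.+1)) ->
  (label (r 0)).1 <> (label (r 0)).2 ->
  forall n, ~~ initial_loop (r n).
Proof.
move=> run_r off_r n; suff : target (r n) != initial G.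
  by rewrite /initial_loop => /negPf->; rewrite andbF.
elim: n => [|n IHn].
  by apply/eqP=> /(tg_initial tgG)[_ [i lab_r]]; rewrite lab_r in off_r.
by apply/eqP=> /(tg_initial tgG)[/eqP]; rewrite -run_r (negPf IHn).
Qed.

Lemma accepts_off_diagonal_run (s t : address m) : accepts G s t -> s 0 <> t 0 ->
  exists r : nat -> edge G, [/\ forall n, target (r n) = source (r n.+1),
    forall n, ~~ initial_loop (r n) & forall n, label (r n) = (s n, t n)].
Proof.
case=> r [_ r_st] st0; have run_r n : target (r n) = source (r n.+1).
  by case: (r_st n).
have lab_r n : label (r n) = (s n, t n) by case: (r_st n).
by exists r; split=> //; apply: off_diagonal_run => //; rewrite lab_r.
Qed.

Local Notation N := #|state G|.

(** The truncated difference and the clamped index let one formula serve on both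
sides of [N]. *)
Definition run_extension (f : {ffun 'I_N.+1 -> edge G}) (n : nat) : edge G :=
  iter (n - N) (@recurrent_succ m G) (f (inord (minn n N))).

Definition extension_labels (f : {ffun 'I_N.+1 -> edge G}) : address m * address m :=
  (fun n => (label (run_extension f n)).1, fun n => (label (run_extension f n)).2).

(** All the runs of critical pairs are extensions of finite prefixes of the same
length, and there are finitely many prefixes. *)
Lemma accepted_critical_finite :
  finite_set [set st : address m * address m |
    accepts G st.1 st.2 /\ st.1 0 <> st.2 0]%classic.
Proof.
apply: (@sub_finite_set _ _ (extension_labels @` setT)%classic); last first.
  exact/finite_image/finite_finset.
case=> s t [/= acc_st st0].
have [r [run_r loop_r lab_r]] := accepts_off_diagonal_run acc_st st0.
exists [ffun i : 'I_N.+1 => r i] => //.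
have ext_r n : run_extension [ffun i : 'I_N.+1 => r i] n = r n.
  rewrite /run_extension ffunE inordK; last by rewrite ltnS geq_minr.
  have [nN | /ltnW Nn] := leqP n N; first by rewrite (eqP nN).
  rewrite -(run_succ initial_entry isolated_cycles run_r loop_r) //.
  by rewrite subnK.
by congr (_, _); apply/funext=> n; rewrite ext_r lab_r.
Qed.

Lemma accepted_critical_preperiodic (s t : address m) : accepts G s t ->
  s 0 <> t 0 -> preperiodic s /\ preperiodic t.
Proof.
move=> acc_st st0.
have [r [run_r loop_r lab_r]] := accepts_off_diagonal_run acc_st st0.
have [k [p [p_gt0 per_r]]] := run_preperiodic initial_entry isolated_cycles run_r loop_r.
have per_lab n : k <= n -> (s (n + p), t (n + p)) = (s n, t n).
  by move=> kn; rewrite -!lab_r per_r.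
by split; exists k, p; split=> // n /per_lab[].
Qed.

End AcceptedCriticalPairs.

(** * Automata in which no edge leaves a cycle *)

Section FunctionalCycles.
Variables (m : nat) (G : automaton m).
Hypothesis cycle_no_exit : forall (c : seq (edge G)) (e f : edge G),
  directed_cycle c -> e \in c -> source f = source e -> f = e.

Lemma directed_cycle_closed (c : seq (edge G)) (e f : edge G) :
  directed_cycle c -> e \in c -> connect (@adjacent m G) (source e) (source f) ->
  f \in c.
Proof.
move=> cyc_c + /connectP[p]; elim: p e => [|y p IHp] e ec /=.
  by move=> _ /(cycle_no_exit cyc_c ec) ->.
case/andP=> /existsP[g /andP[/eqP sg /eqP <-]] p_path last_p.
have [nc te] := directed_cycle_next cyc_c ec.
move: p_path last_p; rewrite (cycle_no_exit cyc_c ec sg) te; exact: IHp.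
Qed.

(** A cycle joined to another one contains an edge of it.  Both cycles are then
the orbit of this edge under the successor function, which is well defined
along any cycle because no edge leaves it. *)
Lemma functional_cycles_isolated : no_path_between_cycles G.
Proof.
move=> c d cyc_c cyc_d not_same [e [f [ec fd conn_ef]]]; apply: not_same.
have fc := directed_cycle_closed cyc_c ec conn_ef.
pose succ (g : edge G) := odflt g [pick h | source h == target g].
have succ_cycle b : directed_cycle b -> fcycle succ b.
  move=> cyc_b; have /and4P[_ cyc _ _] := cyc_b.
  apply: (sub_in_cycle (P := mem b)) cyc; last exact/allP.
  move=> g h gb hb /= /eqP tg; rewrite /succ.
  case: pickP => [k /eqP sk | /(_ h)]; last by rewrite tg eqxx.
  by apply/eqP/(cycle_no_exit cyc_b hb); rewrite sk.
have [i orb_c] := orbit_rot_cycle (succ_cycle c cyc_c) (directed_cycle_uniq cyc_c) fc.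
have [j orb_d] := orbit_rot_cycle (succ_cycle d cyc_d) (directed_cycle_uniq cyc_d) fd.
(* Rotate [c] until it starts at [f], then undo the rotation that makes [d]
   start there. *)
exists (rot_add c i (size d - j)).
by rewrite -rot_rot_add -orb_c orb_d -[d in LHS](rotK j) /rotr size_rot.
Qed.

End FunctionalCycles.

(** * The prefix automaton of finitely many preperiodic sequences *)

Section PrefixAutomaton.
Variables (m : nat) (I : finType) (x : I -> nat -> 'I_m * 'I_m) (N p : nat).
Hypothesis m_gt0 : 0 < m.
Hypothesis N_gt0 : 0 < N.
Hypothesis p_gt0 : 0 < p.
Hypothesis x_off : forall i, (x i 0).1 <> (x i 0).2.
Hypothesis x_sep : forall i j, (forall k, k < N -> x i k = x j k) -> i = j.
Hypothesis x_per : forall i k, N <= k -> x i (k + p) = x i k.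
Variable swap : I -> I.
Hypothesis x_swap : forall i k, x (swap i) k = ((x i k).2, (x i k).1).

(** The section variable [x i] is the [i]-th critical pair, read as a single
sequence of pairs of digits.  Depths from [N] on are identified modulo [p], and
[wrap] gives the representative below [N + p]. *)
Definition wrap (k : nat) : nat := if k < N then k else N + (k - N) %% p.

Lemma wrap_lt k : wrap k < N + p.
Proof.
by rewrite /wrap; case: (ltnP k N) => [/ltn_addr //|_]; rewrite ltn_add2l ltn_pmod.
Qed.

Lemma wrap_small k : k <= N -> wrap k = k.
Proof.
rewrite /wrap; case: ltnP => // ? ?; have -> : k = N by lia.
by rewrite subnn mod0n addn0.
Qed.

Lemma wrap_large k : N <= k -> N <= wrap k.
Proof. by move=> Nk; rewrite /wrap ltnNge Nk /= leq_addr. Qed.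

Lemma wrapK k : wrap (wrap k) = wrap k.
Proof.
rewrite {2 3}/wrap; case: ltnP => kN; first by rewrite wrap_small // ltnW.
by rewrite /wrap ltnNge leq_addr /= addKn modn_mod.
Qed.

Lemma wrapS_eq k l : wrap k = wrap l -> wrap k.+1 = wrap l.+1.
Proof.
rewrite /wrap; case: (ltnP k N) => kN; case: (ltnP l N) => lN kl.
- by rewrite kl.
- by rewrite kl in kN; lia.
- by rewrite -kl in lN; lia.
- rewrite !ltnNge !leqW //= !subSn // -(addn1 (k - N)) -(addn1 (l - N)).
  by rewrite -modnDml (addnI kl) modnDml.
Qed.

Lemma wrapS_le k : wrap k.+1 <= (wrap k).+1.
Proof.
rewrite /wrap; case: (ltnP k N) => kN; case: (ltnP k.+1 N) => SkN; try lia.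
- have -> : k.+1 - N = 0 by lia.
  by rewrite mod0n; lia.
- rewrite subSn // -addnS leq_add2l -addn1 -modnDml addn1.
  exact: leq_mod.
Qed.

Lemma x_wrap i k : x i (wrap k) = x i k.
Proof.
rewrite /wrap; case: ltnP => // kN.
rewrite -[in RHS](subnKC kN) [in RHS](divn_eq (k - N) p).
elim: (_ %/ _) => [|q IHq]; first by rewrite mul0n add0n.
rewrite IHq -x_per ?leq_addr // mulSn; congr (x i _); lia.
Qed.

Lemma swapK : involutive swap.
Proof. by move=> i; apply: x_sep => k _; rewrite !x_swap; case: (x i k). Qed.

Definition agree (i j : I) (n : nat) : bool := [forall k : 'I_n, x i k == x j k].

Lemma agreeP i j n : reflect (forall k, k < n -> x i k = x j k) (agree i j n).
Proof.
apply: (iffP forallP) => [ij k kn | ij k]; first exact/eqP/(ij (Ordinal kn)).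
exact/eqP/ij.
Qed.

Definition prefix_class (i : I) (n : nat) : {set I} := [set j | agree i j n].

Lemma prefix_classP i j n :
  prefix_class i n = prefix_class j n <-> forall k, k < n -> x i k = x j k.
Proof.
split=> [/setP/(_ j) | ij].
  by rewrite !inE => /esym; rewrite (_ : agree j j n) => [/esym/agreeP|]; last exact/agreeP.
by apply/setP=> l; rewrite !inE; apply/agreeP/agreeP=> il k kn; rewrite -il // ij.
Qed.

(** A node of the tree of prefixes is encoded by the set of sequences passing
through it together with its depth.  A set of indices, in contrast to a chosen
index, makes equal prefixes give equal states and is carried along by [swap]. *)
Definition raw_state (i : I) (k : nat) : {set I} * 'I_(N + p) :=
  (prefix_class i (wrap k), Ordinal (wrap_lt k)).

Definition raw_root : {set I} * 'I_(N + p) := ([set: I], Ordinal (wrap_lt 0)).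

(** The root is listed separately because the family of critical pairs may be
empty. *)
Definition prefix_state_pred (v : {set I} * 'I_(N + p)) : bool :=
  (v == raw_root) || [exists i, [exists k : 'I_(N + p), v == raw_state i k]].

Definition prefix_state := {v : {set I} * 'I_(N + p) | prefix_state_pred v}.

Definition root_state : prefix_state :=
  exist _ raw_root (introT orP (or_introl (eqxx _))).

Definition run_state (i : I) (k : nat) : prefix_state :=
  insubd root_state (raw_state i k).

Lemma raw_state_wrap i k : raw_state i (wrap k) = raw_state i k.
Proof. by congr (prefix_class _ _, _); [|apply: val_inj]; rewrite /= wrapK. Qed.

Lemma val_run_state i k : val (run_state i k) = raw_state i k.
Proof.
apply: insubdK; apply/orP; right; apply/existsP; exists i; apply/existsP.
by exists (Ordinal (wrap_lt k)); rewrite raw_state_wrap.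
Qed.

Lemma run_state_eq i j k l : run_state i k = run_state j l <->
  wrap k = wrap l /\ forall n, n < wrap k -> x i n = x j n.
Proof.
split=> [/(congr1 val) | [kl ij]].
  by rewrite !val_run_state => -[+ kl]; rewrite -kl => /prefix_classP.
apply: val_inj; rewrite !val_run_state; congr (_, _); last exact: val_inj.
by rewrite -kl; apply/prefix_classP.
Qed.

Lemma wrap0 : wrap 0 = 0. Proof. exact: wrap_small. Qed.

Lemma run_state0 i : run_state i 0 = root_state.
Proof.
apply: val_inj; rewrite val_run_state /raw_state; congr (_, _).
by apply/setP=> j; rewrite !inE wrap0; apply/agreeP.
Qed.

Lemma run_stateS_neq i k : run_state i k.+1 <> root_state.
Proof.
rewrite -(run_state0 i) => /run_state_eq[]; rewrite wrap0.
case: (leqP k.+1 N) => [/wrap_small -> // | /ltnW/wrap_large]; lia.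
Qed.

Lemma state_cases (v : prefix_state) : v = root_state \/ exists i k, v = run_state i k.
Proof.
case: (orP (valP v)) => [/eqP v_root | /existsP[i /existsP[k /eqP v_ik]]].
  by left; apply: val_inj.
by right; exists i, k; apply: val_inj; rewrite val_run_state.
Qed.

(** This makes the target of an edge independent of the sequence chosen to
represent it: sequences which share a prefix and the next letter share the
longer prefix.  At the place where the depth wraps around, it does not grow and
the common prefix need not grow either. *)
Lemma run_state_step i j k l :
  run_state i k = run_state j l -> x i k = x j l ->
  run_state i k.+1 = run_state j l.+1.
Proof.
case/run_state_eq=> kl ij xkl; apply/run_state_eq.
split=> [|n /leq_trans/(_ (wrapS_le k))].
  exact: wrapS_eq.
rewrite ltnS leq_eqVlt => /predU1P[-> | /ij //].
by rewrite x_wrap kl x_wrap.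
Qed.

Definition prefix_edge_pred (v : prefix_state * ('I_m * 'I_m)) : bool :=
  [exists ik : I * 'I_(N + p), v == (run_state ik.1 ik.2, x ik.1 ik.2)].

(** Apart from the initial loops an edge is a state together with the next letter
of one of the sequences passing through it. *)
Definition prefix_edge :=
  ('I_m + {v : prefix_state * ('I_m * 'I_m) | prefix_edge_pred v})%type.

Definition edge_rep (v : {v | prefix_edge_pred v}) : I * 'I_(N + p) :=
  xchoose (existsP (valP v)).

Definition prefix_automaton : automaton m := {|
  state := prefix_state;
  edge := prefix_edge;
  source := fun e : prefix_edge =>
    match e with inl _ => root_state | inr v => (val v).1 end;
  target := fun e : prefix_edge =>
    match e with
    | inl _ => root_state
    | inr v => run_state (edge_rep v).1 (edge_rep v).2.+1
    end;
  label := fun e : prefix_edge =>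
    match e with inl d => (d, d) | inr v => (val v).2 end;
  initial := root_state
|}.

Local Notation G := prefix_automaton.

Definition loop_edge (d : 'I_m) : edge G := inl d.

Lemma prefix_edge_predP i k : prefix_edge_pred (run_state i k, x i k).
Proof.
apply/existsP; exists (i, Ordinal (wrap_lt k)) => /=.
by rewrite x_wrap; apply/eqP; congr (_, _); apply/run_state_eq; rewrite wrapK.
Qed.

Definition run_edge (i : I) (k : nat) : edge G :=
  inr (exist _ (run_state i k, x i k) (prefix_edge_predP i k)).

Lemma source_run_edge i k : source (run_edge i k) = run_state i k. Proof. by []. Qed.
Lemma label_run_edge i k : label (run_edge i k) = x i k. Proof. by []. Qed.

Lemma target_run_edge i k : target (run_edge i k) = run_state i k.+1.
Proof.
rewrite /=; set v := exist _ _ _.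
have /eqP[sv xv] := xchooseP (existsP (valP v)).
exact/esym/run_state_step.
Qed.

Lemma run_edge_eq i j k l :
  run_state i k = run_state j l -> x i k = x j l -> run_edge i k = run_edge j l.
Proof. by move=> sij xij; congr inr; apply: val_inj; rewrite /= sij xij. Qed.

Lemma edge_cases (e : edge G) :
  (exists d, e = loop_edge d) \/ exists i k, e = run_edge i k.
Proof.
case: e => [d | v]; first by left; exists d.
right; have /existsP[[i k] /eqP vik] := valP v.
by exists i, k; congr inr; apply: val_inj.
Qed.

(** The depth of an edge is known only up to [wrap]; [k] itself may be taken as
the depth, so that depths along a path can be counted without reduction. *)
Lemma source_run_state (e : edge G) i k : source e = run_state i k.+1 ->
  exists2 j, e = run_edge j k.+1 & run_state j k.+1 = run_state i k.+1.
Proof.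
case: (edge_cases e) => [[d ->] | [j [l ->]]] se; first by case: (@run_stateS_neq i k).
rewrite source_run_edge in se; have [lk _] := (run_state_eq _ _ _ _).1 se.
have jlk : run_state j l = run_state j k.+1 by apply/run_state_eq.
by exists j; [apply: run_edge_eq; rewrite // -x_wrap lk x_wrap | rewrite -jlk].
Qed.

Lemma source_root (e : edge G) : source e = root_state ->
  (exists d, e = loop_edge d) \/ exists i, e = run_edge i 0.
Proof.
case: (edge_cases e) => [[d ->] | [i [[|k] ->]]]; first by left; exists d.
  by right; exists i.
by rewrite source_run_edge => /run_stateS_neq.
Qed.

(** A preimage under [swap] is the same as an image, [swap] being an involution. *)
Definition prefix_inv (v : prefix_state) : prefix_state :=
  insubd root_state ([set i | swap i \in (val v).1], (val v).2).

Lemma prefix_inv_root : prefix_inv root_state = root_state.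
Proof.
apply: val_inj; rewrite insubdK /=; last first.
  by apply/orP; left; apply/eqP; congr (_, _); apply/setP=> i; rewrite !inE.
by congr (_, _); apply/setP=> i; rewrite !inE.
Qed.

Lemma prefix_inv_run i k : prefix_inv (run_state i k) = run_state (swap i) k.
Proof.
rewrite /prefix_inv val_run_state /run_state; congr (insubd _ (_, _)).
apply/setP=> j; rewrite !inE /=; apply/agreeP/agreeP => ij n /ij.
  by rewrite !x_swap => ->; case: (x j n).
by rewrite !x_swap => <-; case: (x i n).
Qed.

Lemma run_state_reachable i k : connect (@adjacent m G) root_state (run_state i k).
Proof.
elim: k => [|k IHk]; first by rewrite run_state0 connect0.
apply: connect_trans IHk _; apply: connect1; rewrite -source_run_edge -target_run_edge.
exact: adjacent_edge.
Qed.

Lemma prefix_topology_generating : topology_generating G.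
Proof.
split.
- move=> v; case: (state_cases v) => [-> | [i [k ->]]].
    by exists (loop_edge (Ordinal m_gt0)).
  by exists (run_edge i k).
- move=> v; case: (state_cases v) => [-> | [i [k ->]]]; first exact: connect0.
  exact: run_state_reachable.
- have run_off d i k : source (run_edge i k) = root_state -> label (run_edge i k) <> (d, d).
    case/source_root=> [[d' //] | [j ->]] x_d.
    by apply: (x_off (i := j)); rewrite -label_run_edge x_d.
  move=> e f.
  case: (edge_cases e) => [[d ->] | [i [k ->]]];
    case: (edge_cases f) => [[d' ->] | [j [l ->]]].
  + by move=> _ [->].
  + by move=> /esym/run_off h /esym/h.
  + by move=> /run_off h /h.
  + exact: run_edge_eq.
- exists prefix_inv; split=> [||e]; first exact: prefix_inv_root.
    move=> v; case: (state_cases v) => [-> | [i [k ->]]]; first by rewrite !prefix_inv_root.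
    by rewrite !prefix_inv_run swapK.
  case: (edge_cases e) => [[d ->] | [i [k ->]]].
    by exists (loop_edge d); split; rewrite //= prefix_inv_root.
  exists (run_edge (swap i) k).
  by rewrite !target_run_edge !source_run_edge !prefix_inv_run label_run_edge x_swap.
- by move=> d; exists (loop_edge d).
- move=> e; case: (edge_cases e) => [[d ->] _ | [i [k ->]]].
    by split=> //; exists d.
  by rewrite target_run_edge => /run_stateS_neq.
Qed.

Lemma run_state_large_inj i j k : N <= k -> run_state i k = run_state j k -> i = j.
Proof.
move=> /wrap_large Nk /run_state_eq[_ ij]; apply: x_sep => n nN; apply: ij.
exact: leq_trans Nk.
Qed.

Lemma run_edge_no_exit (e : edge G) i k : N <= k ->
  source e = source (run_edge i k) -> e = run_edge i k.
Proof.
case: k => [|k] Nk; first lia.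
by case/source_run_state=> j -> /(run_state_large_inj Nk) ->.
Qed.

(** Each step along a cycle increases the depth of a run edge, so that going
round often enough exhibits every edge of the cycle as one of depth at least
[N]. *)
Lemma directed_cycle_deep (c : seq (edge G)) (e : edge G) :
  directed_cycle c -> e \in c -> exists i k, N <= k /\ e = run_edge i k.
Proof.
move=> cyc_c ec.
have iter_in n : iter n (next c) e \in c by elim: n => //= n; rewrite mem_next.
have [i [k eik]] : exists i k, e = run_edge i k.
  case: (edge_cases e) => // -[d e_d]; case/and4P: cyc_c => _ _ _ /hasPn/(_ e ec).
  by rewrite e_d /initial_loop !eqxx.
have deep n : exists j, iter n (next c) e = run_edge j (n + k).
  elim: n => [|n [j IHn]]; first by exists i.
  have [_] := directed_cycle_next cyc_c (iter_in n).
  rewrite iterS IHn target_run_edge => /esym/source_run_state[j' -> _].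
  by exists j'.
have [n e_n] := directed_cycle_iter cyc_c (iter_in N) ec.
have [j e_j] := deep (n + N).
by exists j, (n + N + k); split; [lia | rewrite -e_j iterD].
Qed.

Lemma prefix_cycle_no_exit (c : seq (edge G)) (e f : edge G) :
  directed_cycle c -> e \in c -> source f = source e -> f = e.
Proof.
by move=> cyc_c /(directed_cycle_deep cyc_c)[i [k [Nk ->]]]; exact: run_edge_no_exit.
Qed.

Lemma accepts_diagonal (s : address m) : accepts G s s.
Proof. by exists (fun n => loop_edge (s n)). Qed.

Lemma accepts_shifted (s t : address m) i n0 : (forall n, n < n0 -> s n = t n) ->
  (forall k, (s (n0 + k), t (n0 + k)) = x i k) -> accepts G s t.
Proof.
move=> st_eq0 st_x.
pose r n := if n < n0 then loop_edge (s n) else run_edge i (n - n0).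
have src n : source (r n) = run_state i (n - n0).
  by rewrite /r; case: ltnP => // n_n0; rewrite (eqP (ltnW n_n0)) run_state0.
exists r; split=> [|n]; first by rewrite src sub0n run_state0.
rewrite src /r; case: ltnP => n_n0.
  by rewrite (eqP n_n0) run_state0 -st_eq0.
by rewrite target_run_edge subSn // label_run_edge -st_x subnKC.
Qed.

(** The sequence followed by the run is guessed anew at each step, and only at
depth [N] is it determined; the guesses made later must then agree with it. *)
Lemma accepts_off_diagonal (s t : address m) : accepts G s t -> s <> t ->
  exists i n0, (forall n, n < n0 -> s n = t n) /\
    forall k, (s (n0 + k), t (n0 + k)) = x i k.
Proof.
case=> r [r0 r_st] neq_st.
have run_r n : target (r n) = source (r n.+1) by case: (r_st n).
have lab_r n : label (r n) = (s n, t n) by case: (r_st n).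
have [n0 [off_n0 eq_st]] := first_difference neq_st.
have src_diag n : n <= n0 -> source (r n) = root_state.
  elim: n => [|n IHn] n_n0 //; rewrite -run_r.
  case: (source_root (IHn (ltnW n_n0))) => [[d -> //] | [i r_i]].
  case: (x_off (i := i)); rewrite -label_run_edge -r_i lab_r; exact: eq_st.
have start : exists i, r n0 = run_edge i 0.
  case: (source_root (src_diag n0 (leqnn _))) => [[d r_d] | //].
  by case: off_n0; have := lab_r n0; rewrite r_d => -[<- <-].
have follow k : exists i, r (n0 + k) = run_edge i k /\
    forall l, l <= k -> label (r (n0 + l)) = x i l.
  elim: k => [|k [i [r_k lab_k]]].
    by have [i ri] := start; exists i; rewrite addn0; split=> // -[|//]; rewrite addn0 ri.
  have := run_r (n0 + k); rewrite r_k target_run_edge -addnS.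
  case/esym/source_run_state=> j r_j ji; exists j; split=> // l.
  rewrite leq_eqVlt => /predU1P[-> | lk]; first by rewrite r_j.
  rewrite lab_k //; case: (leqP k.+1 N) => [kN | /ltnW Nk].
    by case/run_state_eq: ji => _ ->; rewrite ?wrap_small.
  by rewrite (run_state_large_inj Nk ji).
have [i [_ lab_i]] := follow N.
exists i, n0; split=> // k; rewrite -lab_r.
have [j [_ lab_j]] := follow (maxn k N).
rewrite lab_j ?leq_maxl //; congr (x _ k); apply: x_sep => l lN.
by rewrite -lab_i 1?ltnW // lab_j // (leq_trans (ltnW lN)) ?leq_maxr.
Qed.

End PrefixAutomaton.

(** * Double addresses and critical pairs *)

Section Shifts.
Variables (m : nat) (X : Type) (phi : address m -> X).
Hypothesis phi_cons : forall (s t : address m) (i : 'I_m),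
  phi s = phi t <-> phi (acons i s) = phi (acons i t).

Definition shift (n : nat) (s : address m) : address m := fun k => s (n + k).

(** Common digits may be cancelled one at a time. *)
Lemma phi_shift n (s t : address m) : (forall k, k < n -> s k = t k) ->
  phi s = phi t <-> phi (shift n s) = phi (shift n t).
Proof.
elim: n s t => [|n IHn] s t eq_st; first by [].
have consK (u : address m) : u = acons (u 0) (shift 1 u).
  by apply/funext=> -[].
rewrite (consK s) (consK t) -(eq_st 0) // -phi_cons.
by apply: IHn => k kn; exact: eq_st.
Qed.

(** The tails from the first difference on form a critical pair. *)
Lemma double_address_critical (s t : address m) : phi s = phi t <->
  s = t \/ exists n, (forall k, k < n -> s k = t k) /\
                     critical_pairs phi (shift n s, shift n t).
Proof.
split=> [phi_st | [-> // | [n [eq_st [/= phi_n _]]]]]; last exact/(phi_shift eq_st).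
have [->|neq_st] := pselect (s = t); [by left | right].
have [n [off_n eq_st]] := first_difference neq_st.
exists n; split=> //; split; first exact/(phi_shift eq_st).
by rewrite /= /shift addn0.
Qed.

End Shifts.

(** * The equivalence *)

Lemma pcf_automaton (m : nat) (X : Type) (phi : address m -> X) :
  0 < m ->
  (forall (s t : address m) (i : 'I_m),
     phi s = phi t <-> phi (acons i s) = phi (acons i t)) ->
  post_critically_finite phi ->
  exists G : automaton m,
    [/\ topology_generating G,
        forall s t : address m, accepts G s t <-> phi s = phi t &
        no_path_between_cycles G].
Proof.
move=> m_gt0 phi_cons [/finite_set_enumeration[n [g [g_inj gP]]] pre].
pose x (i : 'I_n) k := ((g i).1 k, (g i).2 k).
have g_crit i : critical_pairs phi (g i) by apply/gP; exists i.
have x_off i : (x i 0).1 <> (x i 0).2 by case: (g_crit i).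
have x_inj i j : (forall k, x i k = x j k) -> i = j.
  move=> eq_x; apply: g_inj; rewrite [g i]surjective_pairing [g j]surjective_pairing.
  by congr (_, _); apply/funext=> k; case: (eq_x k).
have x_pre i : exists k p, 0 < p /\ forall l, k <= l -> x i (l + p) = x i l.
  have := g_crit i; rewrite [g i]surjective_pairing => /pre[].
  case=> k [p [p_gt0 per_s]] [l [q [q_gt0 per_t]]].
  exists (maxn k l), (p * q); split=> [|j]; first by rewrite muln_gt0 p_gt0.
  rewrite geq_max => /andP[kj lj]; congr (_, _).
    exact: period_mul (dvdn_mulr _ _) per_s _ kj.
  exact: period_mul (dvdn_mull _ _) per_t _ lj.
have [p [p_gt0 [K x_per]]] := uniform_period x_pre.
have [L x_sep] := uniform_separation x_inj.
(* The successor makes [N] positive, so that no branch bends back to the root. *)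
pose N := (maxn K L).+1.
have {}x_per i k : N <= k -> x i (k + p) = x i k.
  by move=> Nk; apply: x_per; rewrite /N in Nk; lia.
have {}x_sep i j : (forall k, k < N -> x i k = x j k) -> i = j.
  by apply: x_sep; rewrite /N; lia.
have /choice[swap swP] : forall i, exists j, g j = ((g i).2, (g i).1).
  move=> i; apply/gP; have [phi_i off_i] := g_crit i.
  by split=> //=; exact: nesym.
have x_swap i k : x (swap i) k = ((x i k).2, (x i k).1) by rewrite /x swP.
have N_gt0 : 0 < N by [].
exists (prefix_automaton x N p_gt0); split.
- exact: prefix_topology_generating x_swap.
- move=> s t; rewrite (double_address_critical phi_cons).
  split=> [acc_st | [-> | [k [eq_st]]]].
  + have [->|neq_st] := pselect (s = t); [by left | right].
    have [i [k [eq_st st_x]]] :=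
      accepts_off_diagonal m_gt0 N_gt0 x_off x_sep x_per acc_st neq_st.
    exists k; split=> //; suff <- : g i = (shift k s, shift k t) by [].
    rewrite [LHS]surjective_pairing; congr (_, _); apply/funext=> l;
      by case: (st_x l).
  + exact: accepts_diagonal.
  + case/gP=> i gi; apply: (accepts_shifted m_gt0 N_gt0 p_gt0 x_per eq_st (i := i)) => l.
    by rewrite /x gi.
- apply: functional_cycles_isolated; exact: (prefix_cycle_no_exit m_gt0 N_gt0 x_sep x_per).
Qed.

Lemma automaton_pcf (m : nat) (X : Type) (phi : address m -> X) (G : automaton m) :
  topology_generating G -> (forall s t : address m, accepts G s t <-> phi s = phi t) ->
  no_path_between_cycles G -> post_critically_finite phi.
Proof.
move=> tgG accG isoG; split; last first.
  by move=> s t [/accG acc_st st0]; apply: (accepted_critical_preperiodic tgG isoG).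
apply: sub_finite_set (accepted_critical_finite tgG isoG) => -[s t] [phi_st st0].
by split=> //; apply/accG.
Qed.

Theorem proposition5p1 (m : nat) (m_gt0 : 0 < m) (X : Type)
    (phi : address m -> X) (phi_onto : address_map phi)
    (phi_cons : forall (s t : address m) (i : 'I_m),
       phi s = phi t <-> phi (acons i s) = phi (acons i t)) :
  post_critically_finite phi <->
  exists G : automaton m,
    [/\ topology_generating G,
        forall s t : address m, accepts G s t <-> phi s = phi t &
        no_path_between_cycles G].
Proof.
split=> [|[G [tgG accG isoG]]]; first exact: pcf_automaton.
exact: automaton_pcf accG isoG.
Qed.
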